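(* Every infinite computable tree $T$ has either an infinite computable chain or an infinite $\Pi^0_1$ antichain.
   Context: A tree is a partial order $(T,\preceq)$ with a least element (the root) such that for every $n\in T$ the set $\{m\in T: m\preceq n\}$ is finite and linearly ordered. A tree is computable if $T\subseteq\omega$ is computable and $\preceq$ is computable. A chain is a set of pairwise $\preceq$-comparable nodes; an antichain is a set of pairwise $\preceq$-incomparable nodes. *)

(* Defs.v *)
From mathcomp Require Import all_boot.
From mathcomp Require Import boolp classical_sets functions cardinality.

Set Implicit Arguments.
Unset Strict Implicit.
Unset Printing Implicit Defensive.

Local Open Scope classical_set_scope.

(* The (total) general recursive functions of k variables: the least class     *)
(* containing zero, successor and the projections and closed under             *)
(* composition, primitive recursion and minimization of regular functions,     *)
(* i.e. of functions g such that every v has an n with g (n, v) = 0.           *)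
(* The recursion and minimization variable is the first one. Each rule asks    *)
(* only for pointwise equations on f, so the class is extensional; in          *)
(* recursive_min the regularity of g is implied by the equation for f.         *)
Inductive recursive : forall k : nat, (k.-tuple nat -> nat) -> Prop :=
| recursive_zero k (f : k.-tuple nat -> nat) :
    (forall v, f v = 0) -> recursive f
| recursive_succ (f : 1.-tuple nat -> nat) :
    (forall x, f [tuple x] = x.+1) -> recursive f
| recursive_proj k (i : 'I_k) (f : k.-tuple nat -> nat) :
    (forall v, f v = tnth v i) -> recursive f
| recursive_comp k m (g : m.-tuple nat -> nat)
      (h : 'I_m -> k.-tuple nat -> nat) (f : k.-tuple nat -> nat) :
    recursive g -> (forall i, recursive (h i)) ->
    (forall v, f v = g [tuple h i v | i < m]) -> recursive f
| recursive_primrec k (g : k.-tuple nat -> nat) (h : k.+2.-tuple nat -> nat)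
      (f : k.+1.-tuple nat -> nat) :
    recursive g -> recursive h ->
    (forall v : k.-tuple nat, f [tuple of 0 :: v] = g v) ->
    (forall n (v : k.-tuple nat),
       f [tuple of n.+1 :: v] =
       h [tuple of n :: f [tuple of n :: v] :: v]) ->
    recursive f
| recursive_min k (g : k.+1.-tuple nat -> nat) (f : k.-tuple nat -> nat) :
    recursive g ->
    (forall v : k.-tuple nat,
       g [tuple of f v :: v] = 0 /\
       (forall m, m < f v -> g [tuple of m :: v] <> 0)) ->
    recursive f.

(* A is computable when its characteristic function is. *)
Definition computable k (A : set (k.-tuple nat)) : Prop :=
  recursive (fun v => nat_of_bool `[< A v >]).

Definition computable_set (A : set nat) : Prop :=
  computable [set v : 1.-tuple nat | A (tnth v ord0)].

Definition computable_rel (R : nat -> nat -> Prop) : Prop :=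
  computable [set v : 2.-tuple nat | R (tnth v ord0) (tnth v ord_max)].

Definition Pi01 (A : set nat) : Prop :=
  exists2 R : nat -> nat -> Prop,
    computable_rel R & A = [set x | forall s, R x s].

Definition chain (T : set nat) (le : nat -> nat -> Prop) (C : set nat) : Prop :=
  C `<=` T /\ (forall x y, C x -> C y -> le x y \/ le y x).

Definition antichain (T : set nat) (le : nat -> nat -> Prop) (A : set nat) :
    Prop :=
  A `<=` T /\ (forall x y, A x -> A y -> x <> y -> ~ (le x y \/ le y x)).

(* The order is a relation on T, i.e. a subset of T x T. *)
Record tree (T : set nat) (le : nat -> nat -> Prop) : Prop := Tree {
  tree_dom : forall x y, le x y -> T x /\ T y;
  tree_refl : forall x, T x -> le x x;
  tree_anti : forall x y, le x y -> le y x -> x = y;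
  tree_trans : forall x y z, le x y -> le y z -> le x z;
  tree_root : exists2 r, T r & forall x, T x -> le r x;
  tree_finite : forall n, T n -> finite_set [set m | T m /\ le m n];
  tree_linear : forall n, T n -> chain T le [set m | T m /\ le m n]
}.

Definition computable_tree (T : set nat) (le : nat -> nat -> Prop) : Prop :=
  [/\ tree T le, computable_set T & computable_rel le].

(* Main.v *)
(* The maximal nodes form a Pi^0_1 antichain. If there are only finitely many,
   then so are the nodes below one of them, and some r in T lies below no
   maximal node. Scanning the numbers in increasing order, starting from r and
   moving to each number that lies above the current node, then never gets stuck
   and visits an infinite chain; a number is visited or not at its own stage,
   which makes the chain computable. *)
Require Import Defs.
From mathcomp Require Import all_boot.
From mathcomp Require Import boolp classical_sets functions cardinality.

Set Implicit Arguments.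
Unset Strict Implicit.
Unset Printing Implicit Defensive.

Local Open Scope classical_set_scope.

Lemma recursive_ext k (f g : k.-tuple nat -> nat) :
  f =1 g -> recursive f -> recursive g.
Proof. by move=> /funext->. Qed.

Lemma recursive_comp1 k (g : 1.-tuple nat -> nat) (a : k.-tuple nat -> nat) :
  recursive g -> recursive a -> recursive (fun v => g [tuple a v]).
Proof.
move=> rg ra; apply: (recursive_comp (h := fun=> a) rg) => // v.
by congr g; apply: eq_from_tnth => i; rewrite tnth_mktuple ord1.
Qed.

Lemma recursive_comp2 k (g : 2.-tuple nat -> nat) (a b : k.-tuple nat -> nat) :
  recursive g -> recursive a -> recursive b ->
  recursive (fun v => g [tuple a v; b v]).
Proof.
move=> rg ra rb; apply: (recursive_comp (h := tnth [tuple a; b]) rg).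
  by case=> [[|[|]]].
by move=> v; congr g; apply: eq_from_tnth => -[[|[|]]] // i; rewrite tnth_mktuple.
Qed.

Lemma recursive_comp3 k (g : 3.-tuple nat -> nat) (a b c : k.-tuple nat -> nat) :
  recursive g -> recursive a -> recursive b -> recursive c ->
  recursive (fun v => g [tuple a v; b v; c v]).
Proof.
move=> rg ra rb rc; apply: (recursive_comp (h := tnth [tuple a; b; c]) rg).
  by case=> [[|[|[|]]]].
by move=> v; congr g; apply: eq_from_tnth => -[[|[|[|]]]] // i;
  rewrite tnth_mktuple.
Qed.

Lemma recursive_tnth k (i : 'I_k) : recursive (fun v => tnth v i).
Proof. exact: (@recursive_proj _ i). Qed.

Lemma recursive_const k c : recursive (fun _ : k.-tuple nat => c).
Proof.
elim: c => [|c IH]; first exact: recursive_zero.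
apply: (recursive_comp1 (g := fun v => (tnth v ord0).+1) _ IH).
exact: recursive_succ.
Qed.

Lemma recursive_if k (b : k.-tuple nat -> bool) (x y : k.-tuple nat -> nat) :
  recursive (fun v => nat_of_bool (b v)) -> recursive x -> recursive y ->
  recursive (fun v => if b v then x v else y v).
Proof.
move=> rb rx ry.
pose cond (v : 3.-tuple nat) :=
  if tnth v ord0 == 0 then tnth v (inord 2) else tnth v (inord 1).
have rcond : recursive cond.
  (* Recursion on the condition: at 0 the remaining tuple is [(x, y)], whose entry 1 is [y]; at a
     successor it is [(n, previous value, x, y)], whose entry 2 is [x]. *)
  apply: (recursive_primrec (recursive_tnth (inord 1 : 'I_2))
                            (recursive_tnth (inord 2 : 'I_4))) => [v|n v];
  by rewrite /cond !(tnth_nth 0) /= !inordK.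
apply: recursive_ext (recursive_comp3 rcond rb rx ry) => v.
by rewrite /cond !(tnth_nth 0) /= !inordK //; case: (b v).
Qed.

(** Composition allows recursive functions to be substituted for both arguments; the two projections
    give the converse. *)
Lemma computable_relP (R : nat -> nat -> Prop) :
  computable_rel R <->
  forall k (a b : k.-tuple nat -> nat), recursive a -> recursive b ->
    recursive (fun v => nat_of_bool `[< R (a v) (b v) >]).
Proof.
split=> [rR k a b ra rb|]; last by apply; exact: recursive_tnth.
by apply: recursive_ext (recursive_comp2 rR ra rb) => v;
  rewrite /= !(tnth_nth 0).
Qed.

(* [le x x] says that [x] is a node; since [le] is antisymmetric, [le y x] stands
   for [y = x] and keeps equality out of the computability proof. *)
Definition maximal (le : nat -> nat -> Prop) (x : nat) : Prop :=
  le x x /\ forall y, le x y -> le y x.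

Lemma Pi01_maximal (le : nat -> nat -> Prop) :
  computable_rel le -> Pi01 (maximal le).
Proof.
move=> /computable_relP rle.
(* Being a node does not depend on [y], so it moves under the quantifier; the instance at 0 gives it
   back. *)
exists (fun x y => le x x /\ (le x y -> le y x)); last first.
  apply/seteqP; split=> [x [xx m] y|x m]; first by split=> //; apply: m.
  by split=> [|y]; [have [] := m 0|have [] := m y].
apply/computable_relP => k a b ra rb.
apply: (@recursive_ext _ (fun v => if `[< le (a v) (a v) >] then
  if `[< le (a v) (b v) >] then nat_of_bool `[< le (b v) (a v) >] else 1
  else 0)) => [v|]; first by rewrite asbool_and asbool_imply; do 3 case: asbool.
apply: recursive_if; [exact: rle| |exact: recursive_const].
by apply: recursive_if; [exact: rle|exact: rle|exact: recursive_const].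
Qed.

(** The bound is exclusive: stage [n] has scanned only the numbers below [n]. Thus [y] is tested
    against the node held at stage [y] and, if accepted, is held at stage [y.+1]. *)
Fixpoint climb (le : nat -> nat -> Prop) (r n : nat) : nat :=
  if n is m.+1 then
    if `[< le (climb le r m) m >] then m else climb le r m
  else r.

Lemma recursive_climb (le : nat -> nat -> Prop) r :
  computable_rel le ->
  recursive (fun v : 1.-tuple nat => climb le r (tnth v ord0)).
Proof.
move=> /computable_relP rle.
pose step (v : 2.-tuple nat) :=
  if `[< le (tnth v ord_max) (tnth v ord0) >] then tnth v ord0
  else tnth v ord_max.
have rstep : recursive step.
  apply: recursive_if; [|exact: recursive_tnth..].
  by apply: rle; exact: recursive_tnth.
apply: (recursive_primrec (recursive_const 0 r) rstep) => [v|n v].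
  by rewrite !(tnth_nth 0).
by rewrite /step tuple0 !(tnth_nth 0).
Qed.

Definition visited (le : nat -> nat -> Prop) (r : nat) : set nat :=
  [set y | le (climb le r y) y].

Lemma computable_visited (le : nat -> nat -> Prop) r :
  computable_rel le -> computable_set (visited le r).
Proof.
move=> cle; have /computable_relP rle := cle.
by apply: rle; [exact: recursive_climb|exact: recursive_tnth].
Qed.

Section Tree.
Variables (T : set nat) (le : nat -> nat -> Prop).
Hypothesis treeT : tree T le.

Let trans := tree_trans treeT.
Let refl := tree_refl treeT.

Lemma antichain_maximal : antichain T le (maximal le).
Proof.
split=> [x [/(tree_dom treeT)[]]//|x y [_ mx] [_ my] xy [le_xy|le_yx]].
  by apply: xy; apply: (tree_anti treeT) (mx _ _).
by apply: xy; apply: (tree_anti treeT) (my _ _) _.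
Qed.

Lemma exists_not_below_maximal :
  infinite_set T -> finite_set (maximal le) ->
  exists2 r, T r & forall l, maximal le l -> ~ le r l.
Proof.
move=> infT finM; apply: contrapT => none; apply: infT.
apply: (@sub_finite_set _ _
  (\bigcup_(l in maximal le) [set m | T m /\ le m l])); last first.
  apply: bigcup_finite => // l [/(tree_dom treeT)[Tl _] _].
  exact: (tree_finite treeT).
move=> r Tr; apply: contrapT => nr; apply: none; exists r => // l ml rl.
by apply: nr; exists l.
Qed.

Variable r : nat.
Hypothesis Tr : T r.

Lemma climb_dom n : T (climb le r n).
Proof.
elim: n => //= n IH; case: asboolP => // /(tree_dom treeT)[]//.
Qed.

Lemma climb_mono m n : m <= n -> le (climb le r m) (climb le r n).
Proof.
elim: n => [|n IH]; first by rewrite leqn0 => /eqP->; exact: refl.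
rewrite leq_eqVlt => /predU1P[->|/IH mn]; first exact/refl/climb_dom.
by rewrite /=; case: asboolP => // /(trans mn).
Qed.

Lemma climb_visited y : visited le r y -> climb le r y.+1 = y.
Proof. by rewrite /visited /= => /asboolP->. Qed.

Lemma chain_visited : chain T le (visited le r).
Proof.
split=> [y /(tree_dom treeT)[]//|x y].
(* Since [a.+1 <= b], the node [a], held at stage [a.+1], lies below the node held at stage [b],
   which lies below [b]. *)
have lt_le a b : visited le r a -> visited le r b -> a < b -> le a b.
  move=> va vb /climb_mono; rewrite climb_visited // => /trans; exact.
move=> vx vy; case: (ltngtP x y) => [xy|yx|<-].
- by left; apply: lt_le.
- by right; apply: lt_le.
- by left; apply: refl; have [] := tree_dom treeT vx.
Qed.

(** If [m] is above the current node, it was already above the node held at stage [m]; so the climb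
    moved to [m] then and has only gone up since. Hence no number passed over becomes eligible
    later, and a single scan suffices. *)
Lemma climb_above n m : m < n -> le (climb le r n) m -> le m (climb le r n).
Proof.
elim: n => //= n IH; rewrite ltnS leq_eqVlt.
case: asboolP => [dn|ndn] /predU1P[->//|mn] dm.
  by apply: trans (IH mn (trans dn dm)) dn.
exact: IH.
Qed.

Hypothesis r_free : forall l, maximal le l -> ~ le r l.

Lemma visited_unbounded N : exists2 y, N <= y & visited le r y.
Proof.
apply: contrapT => none.
(* Without visits from [N] on, the climb is frozen at its node of stage [N]. *)
have stuck n : N <= n -> climb le r n = climb le r N.
  elim: n => [|n IH]; first by rewrite leqn0 => /eqP->.
  rewrite leq_eqVlt => /predU1P[->//|Nn] /=.
  by case: asboolP => [v|_]; [case: none; exists n|exact: IH].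
apply: (r_free _ (climb_mono (leq0n N))); split=> [|z dz].
  exact/refl/climb_dom.
have [zN|Nz] := ltnP z N; first exact: climb_above.
by case: none; exists z; rewrite // /visited /= stuck.
Qed.

Lemma infinite_visited : infinite_set (visited le r).
Proof.
move=> /finite_seqP[s vs].
have [y lt_y] := visited_unbounded (\max_(x <- s) x).+1.
rewrite vs /= => ys.
by move: lt_y; rewrite ltnNge (leq_bigmax_seq (F := id) y ys).
Qed.

End Tree.

Theorem theorem6p2 (T : set nat) (le : nat -> nat -> Prop) :
  computable_tree T le ->
  infinite_set T ->
  (exists C : set nat, [/\ infinite_set C, computable_set C & chain T le C]) \/
  (exists A : set nat, [/\ infinite_set A, Pi01 A & antichain T le A]).
Proof.
move=> [treeT _ cle] infT.
(* This case split and the choice of [r] are classical; [r] then enters the recursive functions as a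
   fixed constant. *)
have [finM|infM] := pselect (finite_set (maximal le)); last first.
  right; exists (maximal le); split=> //; first exact: Pi01_maximal.
  exact: antichain_maximal.
have [r Tr r_free] := exists_not_below_maximal treeT infT finM.
left; exists (visited le r); split.
- exact: (infinite_visited treeT).
- exact: computable_visited.
- exact: chain_visited.
Qed.
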